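(* Let $\mathcal{G}$ be a finite connected simple graph with at most three coherent components. A coherent component is called white if it induces a discrete (edgeless) graph (this includes single-vertex components) and black if it induces a complete graph on at least two vertices. Then $\mathcal{G}$ is of one of the following types, where the letters $r,s,t\ge 1$ denote the numbers of vertices of the corresponding components, and $\mathcal{G}$ is positive exactly under the stated condition. One coherent component: (1) complete graph on $r$ vertices: always positive. Two (adjacent) coherent components: (2) both white, with $r$ and $s$ vertices: always positive. (3) one white with $r$ vertices and one black with $s$ vertices: positive if and only if $s\ge r$. Three coherent components, pairwise adjacent: (4) all white, with $r,s,t$ vertices: positive if and only if $r+s\ge t$, $s+t\ge r$ and $t+r\ge s$. (5) two white with $r$ and $s$ vertices, and one black with $t$ vertices: positive if and only if $1+t>|r-s|$. Three coherent components with sizes $r,s,t$, where the component with $s$ vertices is adjacent to both others, and the components with $r$ and $t$ vertices are not adjacent to each other: (6) $r$ white, $s$ white, $t$ black: positive if and only if $r+t(1-r+s)>0$ and $t+r\ge s$. (7) $r$ white, $s$ black, $t$ black: positive if and only if $(s+t)(s-r)>(r-1)(t-1)$. (8) $r$ black, $s$ white, $t$ black: positive if and only if $r+t\ge s$. (9) $r$ black, $s$ black, $t$ black: always positive.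
   Context: Positivity: a finite simple graph with edges $l_1,\dots,l_q$ is positive if there are real numbers $c_1,\dots,c_q>0$ and $\nu>0$ with $3c_k+\sum_{l_m\sim l_k}c_m=\nu$ for every $k$, where the sum is over the edges $l_m\neq l_k$ sharing a vertex with $l_k$ (a graph with no edges is positive). Coherent components: for a vertex $\alpha$ let $\Omega'(\alpha)$ be the set of its neighbours and $\Omega(\alpha)=\Omega'(\alpha)\cup\{\alpha\}$. The relation $\alpha\sim\beta$ iff $\Omega'(\alpha)\subseteq\Omega(\beta)$ and $\Omega'(\beta)\subseteq\Omega(\alpha)$ is an equivalence relation on the vertex set, and its classes are the coherent components. Each coherent component induces either a complete or a discrete graph, and between two distinct coherent components either all possible edges are present (the components are then called adjacent) or none are. *)

(* Defs.v *)
From mathcomp Require Export all_boot all_order all_algebra.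
From mathcomp Require Export reals.

Set Implicit Arguments.
Unset Strict Implicit.
Unset Printing Implicit Defensive.

Import Order.TTheory GRing.Theory Num.Theory.

(* A finite simple graph is a symmetric irreflexive relation [e] on a finite
   type [T]; [e x y] means that x and y are joined by an edge. *)

Section Graph.
Variables (T : finType) (e : rel T).

Definition connected_graph : Prop :=
  0 < #|T| /\ forall x y : T, connect e x y.

(* An edge is represented by the two-element set of its end vertices. *)
Definition edges : {set {set T}} :=
  [set [set p.1; p.2] | p : T * T & e p.1 p.2].

(* The values of [c] on sets that are not edges play no role. *)
Definition positive_graph (R : realType) : Prop :=
  exists (c : {set T} -> R) (nu : R),
    [/\ (forall l, l \in edges -> 0 < c l)%R, (0 < nu)%R
      & forall l, l \in edges ->
          (3 * c l + \sum_(m in edges | (m != l) && (m :&: l != set0)) c m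
           = nu)%R].

Definition neighbours (x : T) : {set T} := [set y | e x y].

Definition closed_neighbours (x : T) : {set T} := x |: neighbours x.

Definition coherent : rel T := fun x y =>
  (neighbours x \subset closed_neighbours y)
  && (neighbours y \subset closed_neighbours x).

Definition coherent_components : {set {set T}} :=
  equivalence_partition coherent [set: T].

Definition complete_on (A : {set T}) : Prop :=
  {in A &, forall x y, x != y -> e x y}.

Definition discrete_on (A : {set T}) : Prop :=
  {in A &, forall x y, ~~ e x y}.

Definition white (A : {set T}) : Prop := discrete_on A.

Definition black (A : {set T}) : Prop := 2 <= #|A| /\ complete_on A.

Definition adjacent (A B : {set T}) : Prop :=
  {in A & B, forall x y, e x y}.

Definition nonadjacent (A B : {set T}) : Prop :=
  {in A & B, forall x y, ~~ e x y}.

Definition two_adjacent (A B : {set T}) : Prop :=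
  [/\ A != B, coherent_components = [set A; B] & adjacent A B].

Definition three_components (A B C : {set T}) : Prop :=
  uniq [:: A; B; C] /\ coherent_components = [set A; B; C].

Definition three_pairwise_adjacent (A B C : {set T}) : Prop :=
  [/\ three_components A B C, adjacent A B, adjacent B C & adjacent A C].

Definition three_path (A B C : {set T}) : Prop :=
  [/\ three_components A B C, adjacent A B, adjacent B C & nonadjacent A C].

Definition type1 (r : nat) : Prop :=
  [/\ coherent_components = [set [set: T]], complete_on [set: T] & #|T| = r].

Definition type2 (r s : nat) : Prop :=
  exists A B, [/\ two_adjacent A B, white A, white B, #|A| = r & #|B| = s].

Definition type3 (r s : nat) : Prop :=
  exists A B, [/\ two_adjacent A B, white A, black B, #|A| = r & #|B| = s].

Definition type4 (r s t : nat) : Prop :=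
  exists A B C, [/\ three_pairwise_adjacent A B C,
    [/\ white A, white B & white C] & [/\ #|A| = r, #|B| = s & #|C| = t]].

Definition type5 (r s t : nat) : Prop :=
  exists A B C, [/\ three_pairwise_adjacent A B C,
    [/\ white A, white B & black C] & [/\ #|A| = r, #|B| = s & #|C| = t]].

Definition type6 (r s t : nat) : Prop :=
  exists A B C, [/\ three_path A B C,
    [/\ white A, white B & black C] & [/\ #|A| = r, #|B| = s & #|C| = t]].

Definition type7 (r s t : nat) : Prop :=
  exists A B C, [/\ three_path A B C,
    [/\ white A, black B & black C] & [/\ #|A| = r, #|B| = s & #|C| = t]].

Definition type8 (r s t : nat) : Prop :=
  exists A B C, [/\ three_path A B C,
    [/\ black A, white B & black C] & [/\ #|A| = r, #|B| = s & #|C| = t]].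

Definition type9 (r s t : nat) : Prop :=
  exists A B C, [/\ three_path A B C,
    [/\ black A, black B & black C] & [/\ #|A| = r, #|B| = s & #|C| = t]].

End Graph.

(* Main.v *)
Require Import Defs.
From mathcomp Require Import ring lra zify.
Import Order.TTheory GRing.Theory Num.Theory.

Set Implicit Arguments.
Unset Strict Implicit.
Unset Printing Implicit Defensive.

(** Write [nu = 2]. On an edge xy the defining equation reads
    [c_xy = 2 - d x - d y], with [d x] the sum of [c] over the edges at x, so
    [c_xy = u x + u y] with [u x = 1 - d x], and positivity means that the
    system [(1 + deg x) u x + \sum_(y ~ x) u y = 1] has a solution with
    [u x + u y > 0] on every edge. Coherent vertices are twins, which forces
    [u] to be constant on coherent components; as these form an equitable
    partition, the system descends to one unknown per component. With at most
    three components it is solved explicitly, and the signs of the numerators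
    give the stated inequalities. *)

(** * Twins and the quotient by coherent components *)

Section Twins.
Variables (T : finType) (e : rel T).
Hypotheses (e_sym : symmetric e) (e_irr : irreflexive e).

(** The two inclusions leave only the pair [x], [y] itself free, so adjacent and non-adjacent twins
    are treated alike. *)
Lemma coherentP x y :
  reflect (forall z, z != x -> z != y -> e x z = e y z) (coherent e x y).
Proof.
apply: (iffP andP) => [[/subsetP xy /subsetP yx] z zx zy|twin].
  apply/idP/idP => ez.
    by have := xy z; rewrite !inE (negPf zy) => /(_ ez).
  by have := yx z; rewrite !inE (negPf zx) => /(_ ez).
split; apply/subsetP => z; rewrite !inE => ez.
  case: eqVneq => //= zy; rewrite -twin //.
  by apply: contraTneq ez => ->; rewrite e_irr.
case: eqVneq => //= zx; rewrite twin //.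
by apply: contraTneq ez => ->; rewrite e_irr.
Qed.

Lemma coherent_equiv : {in [set: T] & &, equivalence_rel (coherent e)}.
Proof.
have symc x y : coherent e x y = coherent e y x by rewrite /coherent andbC.
have trans x y z : coherent e x y -> coherent e y z -> coherent e x z.
  move=> /coherentP xy /coherentP yz; apply/coherentP => w wx wz.
  have [wy|wy] := eqVneq w y; last by rewrite xy // yz.
  (* At the middle vertex [y] neither hypothesis applies directly; the equalities [e y x = e z x]
     and [e x z = e y z] go round it by symmetry. *)
  rewrite {w}wy in wx wz *; have [->//|zx] := eqVneq z x.
  have zy : z != y by rewrite eq_sym.
  by rewrite e_sym yz 1?eq_sym // e_sym xy // e_sym.
move=> x y z _ _ _; split; first by apply/coherentP.
by move=> xy; apply/idP/idP; apply: trans => //; rewrite symc.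
Qed.

Local Notation P := (coherent_components e).

Lemma coherent_partition : partition P [set: T].
Proof. exact: equivalence_partitionP coherent_equiv. Qed.

Lemma coherent_component_coherent A x y :
  A \in P -> x \in A -> (y \in A) = coherent e x y.
Proof.
move=> AP xA; have [_ /trivIsetP tP _] := and3P coherent_partition.
have := pblock_equivalence_partition coherent_equiv (in_setT x) (in_setT y).
by rewrite (def_pblock _ AP xA) //; apply/trivIsetP.
Qed.

Lemma coherent_component_neq0 A : A \in P -> A != set0.
Proof.
by move=> AP; apply: contraTneq AP => ->; rewrite (partition0 coherent_partition).
Qed.

Lemma coherent_component_disjoint A B x :
  A \in P -> B \in P -> x \in A -> x \in B -> A = B.
Proof.
move=> AP BP xA xB; have [_ tP _] := and3P coherent_partition.
by rewrite -(def_pblock tP AP xA) (def_pblock tP BP xB).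
Qed.

(** One end is exchanged at a time: the opposite end lies in a disjoint class, hence differs from
    both twins. *)
Lemma component_edge_eq A B x x' y y' :
  A \in P -> B \in P -> A != B -> x \in A -> x' \in A -> y \in B -> y' \in B ->
  e x y = e x' y'.
Proof.
move=> AP BP AB xA x'A yB y'B.
have dis z w : z \in A -> w \in B -> w != z.
  move=> zA wB; apply: contraNneq AB => wz.
  by rewrite (coherent_component_disjoint AP BP zA) // -wz.
have /coherentP xx' : coherent e x x' by rewrite -(coherent_component_coherent _ AP xA).
have /coherentP yy' : coherent e y y' by rewrite -(coherent_component_coherent _ BP yB).
by rewrite xx' ?dis // e_sym yy' 1?e_sym // eq_sym dis.
Qed.

Lemma component_adjacentVnonadjacent A B :
  A \in P -> B \in P -> A != B -> adjacent e A B \/ nonadjacent e A B.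
Proof.
move=> AP BP AB.
have [x xA] := set0Pn _ (coherent_component_neq0 AP).
have [y yB] := set0Pn _ (coherent_component_neq0 BP).
case: (boolP (e x y)) => exy; [left|right] => x' y' x'A y'B;
  by rewrite -(component_edge_eq AP BP AB xA x'A yB y'B).
Qed.

(** One edge spreads over the class: its end [x] is joined to every twin of the other end, and each
    further vertex inherits this as a twin of [x]. *)
Lemma component_whiteVblack A : A \in P -> white e A \/ black e A.
Proof.
move=> AP.
case: (boolP [exists x in A, exists y in A, e x y]); last first.
  move=> /exists_inPn nA; left => x y xA yA.
  by apply: contra (nA _ xA) => exy; apply/exists_inP; exists y.
move=> /exists_inP[x xA /exists_inP[y yA exy]]; right.
have xy : x != y by apply: contraTneq exy => ->; rewrite e_irr.
split; first by apply/card_gt1P; exists x, y.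
have twin : {in A &, forall a b z, z != a -> z != b -> e a z = e b z}.
  by move=> a b aA bA; apply/coherentP; rewrite -(coherent_component_coherent _ AP aA).
have star z : z \in A -> z != x -> e x z.
  move=> zA zx; have [->//|zy] := eqVneq z y.
  by rewrite e_sym (twin z y) // 1?eq_sym // e_sym.
move=> a b aA bA ab; have [ax|ax] := eqVneq a x.
  by rewrite ax star // -ax eq_sym.
have [->|bx] := eqVneq b x; first by rewrite e_sym star.
by rewrite (twin a x) ?star // eq_sym.
Qed.

(** Equitability is what permits a quotient system: off the diagonal [component_edge_eq] applies,
    and on it a white class gives [0], a black one [#|A|.-1]. *)
Lemma equitable_components A B x x' :
  A \in P -> B \in P -> x \in A -> x' \in A ->
  #|[set y in B | e x y]| = #|[set y in B | e x' y]|.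
Proof.
move=> AP BP xA x'A; have [AB|AB] := eqVneq A B; last first.
  apply: eq_card => y; rewrite !inE; case yB: (y \in B) => //=.
  exact: (component_edge_eq AP BP AB).
rewrite -{B BP}AB; case: (component_whiteVblack AP) => [wA|[_ bA]].
  rewrite (_ : [set y in A | e x y] = set0) 1?(_ : [set y in A | e x' y] = set0) //;
  by apply/setP => y; rewrite !inE; apply/negP => /andP[yA]; apply/negP/wA.
have nbrs z : z \in A -> #|[set y in A | e z y]| = #|A|.-1.
  move=> zA; rewrite (cardsD1 z A) zA /=; apply: eq_card => y.
  rewrite !inE; have [->|yz] /= := eqVneq y z; first by rewrite e_irr andbF.
  by case yA: (y \in A) => //=; apply: bA => //; rewrite eq_sym.
by rewrite !nbrs.
Qed.

(* Entry of the quotient matrix: for a component [A] every vertex gives the same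
   count; [0] if [A] is empty. *)
Definition quotient_degree (A B : {set T}) : nat :=
  if [pick x in A] is Some x then #|[set y in B | e x y]| else 0.

Lemma quotient_degreeE A B x :
  A \in P -> B \in P -> x \in A -> #|[set y in B | e x y]| = quotient_degree A B.
Proof.
rewrite /quotient_degree => AP BP xA; case: pickP => [z zA|/(_ x)]; last by rewrite xA.
exact: (equitable_components AP).
Qed.

Lemma quotient_degree_adjacent A B :
  A != set0 -> adjacent e A B -> quotient_degree A B = #|B|.
Proof.
move=> /set0Pn[z zA] AB; rewrite /quotient_degree.
case: pickP => [x xA|/(_ z)]; last by rewrite zA.
by apply: eq_card => y; rewrite !inE; case yB: (y \in B) => //=; rewrite AB.
Qed.

Lemma quotient_degree_nonadjacent A B :
  nonadjacent e A B -> quotient_degree A B = 0.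
Proof.
move=> AB; rewrite /quotient_degree; case: pickP => // x xA.
apply: eq_card0 => y; rewrite !inE; apply/negP => /andP[yB].
by apply/negP/AB.
Qed.

Lemma quotient_degree_white A : white e A -> quotient_degree A A = 0.
Proof. exact: quotient_degree_nonadjacent. Qed.

Lemma quotient_degree_complete A :
  complete_on e A -> quotient_degree A A = #|A|.-1.
Proof.
move=> bA; rewrite /quotient_degree; case: pickP => [x xA|A0]; last first.
  by rewrite (eq_card0 A0).
rewrite (cardsD1 x A) xA /=; apply: eq_card => y.
rewrite !inE; have [->|yx] /= := eqVneq y x; first by rewrite e_irr andbF.
by case yA: (y \in A) => //=; apply: bA => //; rewrite eq_sym.
Qed.

Lemma adjacent_sym A B : adjacent e A B -> adjacent e B A.
Proof. by move=> AB x y xB yA; rewrite e_sym AB. Qed.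

Lemma nonadjacent_sym A B : nonadjacent e A B -> nonadjacent e B A.
Proof. by move=> AB x y xB yA; rewrite e_sym AB. Qed.

End Twins.

(** * Reduction of positivity to a linear system *)

Section Positivity.
Local Open Scope ring_scope.
Variables (R : realType) (T : finType) (e : rel T).
Hypotheses (e_sym : symmetric e) (e_irr : irreflexive e).

Lemma edgesP (l : {set T}) :
  reflect (exists x y, e x y /\ l = [set x; y]) (l \in edges e).
Proof.
apply: (iffP imsetP) => [[[x y]]|[x [y [exy ->]]]].
  by rewrite inE => exy ->; exists x, y.
by exists (x, y); rewrite ?inE.
Qed.

Lemma pair_edges x y : e x y -> [set x; y] \in edges e.
Proof. by move=> exy; apply/edgesP; exists x, y. Qed.

Lemma sum_edges_at (c : {set T} -> R) x :
  \sum_(m in edges e | x \in m) c m = \sum_(y | e x y) c [set x; y].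
Proof.
rewrite -(big_imset (h := fun y => [set x; y]) (A := [pred y | e x y]) c) /=; last first.
  move=> y z; rewrite !inE => exy _ /setP /(_ y); rewrite !inE eqxx orbT.
  by case: eqVneq => [yx|_ /esym/eqP//]; move: exy; rewrite yx e_irr.
apply: eq_bigl => m; apply/andP/imsetP => [[/edgesP[a [b [eab ->]]]]|[y]].
  rewrite !inE => /orP[]/eqP->; first by exists b.
  by exists a; rewrite ?inE 1?e_sym // setUC.
by rewrite inE => exy ->; rewrite pair_edges // !inE eqxx.
Qed.

(** Every other edge meeting [[set x; y]] shares exactly one end with it, so the two stars together
    count such an edge once and [[set x; y]] twice. *)
Lemma sum_incident_edges (c : {set T} -> R) x y : e x y ->
  \sum_(m in edges e | (m != [set x; y]) && (m :&: [set x; y] != set0)) c m =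
  \sum_(z | e x z) c [set x; z] + \sum_(z | e y z) c [set y; z]
    - 2 * c [set x; y].
Proof.
move=> exy; have lE := pair_edges exy; rewrite -!sum_edges_at.
have xy : x != y by apply: contraTneq exy => ->; rewrite e_irr.
rewrite [X in _ = X + _ - _](bigD1 [set x; y]) /=; last by rewrite lE !inE eqxx.
rewrite [X in _ = _ + X - _](bigD1 [set x; y]) /=; last by rewrite lE !inE eqxx orbT.
(* The part with [x \in m] is the star of [x] without the edge; the rest is, by [only], the star of
   [y] without it. *)
rewrite (bigID (fun m : {set T} => x \in m)) /=.
set S1 := (X in X + _ = _); set S2 := (X in _ + X = _).
set S3 := (X in _ = _ + X + _ - _); set S4 := (X in _ = _ + (_ + X) - _).
have only m : m \in edges e -> x \in m -> y \in m -> m = [set x; y].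
  move=> /edgesP[a [b [eab ->]]]; rewrite !inE.
  by do 2![case/orP=> /eqP ?]; subst; rewrite ?eqxx in xy *; rewrite 1?setUC.
have -> : S1 = S3.
  apply: eq_bigl => m; case mE: (m \in edges e) => //=.
  case xm: (x \in m) => /=; rewrite ?andbF // andbT.
  by rewrite (_ : _ != set0) ?andbT //; apply/set0Pn; exists x; rewrite !inE xm eqxx.
have -> : S2 = S4; last by ring.
apply: eq_bigl => m; case mE: (m \in edges e) => //=.
case: eqVneq => [->|ml] //=; first by rewrite andbF.
rewrite andbT; case: (boolP (y \in m)) => ym.
  rewrite (_ : _ != set0) /=; last by apply/set0Pn; exists y; rewrite !inE ym eqxx orbT.
  by apply: contra ml => xm; apply/eqP/only.
apply/negP => /andP[/set0Pn[z]]; rewrite !inE => /andP[zm /orP[]/eqP zE].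
  by rewrite -zE zm.
by rewrite -zE zm in ym.
Qed.

Lemma positive_graphP :
  positive_graph e R <->
  exists u : T -> R,
    (forall x, (1 + #|[set y | e x y]|%:R) * u x + \sum_(y | e x y) u y = 1) /\
    (forall x y, e x y -> 0 < u x + u y).
Proof.
have sum1 x (a : R) : \sum_(y | e x y) a = #|[set y | e x y]|%:R * a.
  rewrite sumr_const mulr_natl; congr (_ *+ _).
  by apply: eq_card => y; rewrite inE.
split=> [[c [nu [c_gt0 nu_gt0 c_eq]]]|[u [u_eq u_gt0]]].
  pose d x := \sum_(y | e x y) c [set x; y].
  have cE x y : e x y -> c [set x; y] = nu - d x - d y.
    move=> exy; have := c_eq _ (pair_edges exy).
    by rewrite sum_incident_edges // -/(d x) -/(d y) => <-; ring.
  have dE x : d x = #|[set y | e x y]|%:R * (nu - d x) - \sum_(y | e x y) d y.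
    rewrite {1}/d (eq_bigr (fun y => nu - d x - d y)) => [|y]; last exact: cE.
    by rewrite sumrB sum1.
  (* This is [1 - d x] after rescaling to [nu = 2]; its sum over the ends of an edge is
     [2 * c / nu]. *)
  exists (fun x => (nu - 2 * d x) / nu); split=> [x|x y exy].
    rewrite -mulr_suml sumrB sum1 -mulr_sumr.
    have -> : \sum_(y | e x y) d y = #|[set y | e x y]|%:R * (nu - d x) - d x.
      by have := dE x; lra.
    by field; rewrite gt_eqF.
  rewrite -mulrDl divr_gt0 //; have := c_gt0 _ (pair_edges exy).
  by rewrite cE //; lra.
have cE x y : e x y -> \sum_(z in [set x; y]) u z = u x + u y.
  move=> exy; rewrite big_setU1 ?big_set1 //= inE.
  by apply: contraTneq exy => ->; rewrite e_irr.
(* Each edge gets the sum of [u] over its ends; the system then says that the weights at [x] add up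
   to [1 - u x]. *)
exists (fun l : {set T} => \sum_(z in l) u z), 2; split=> // [l /edgesP[x [y [exy ->]]]|l].
  by rewrite cE // u_gt0.
have dE x : \sum_(z | e x z) \sum_(w in [set x; z]) u w = 1 - u x.
  rewrite (eq_bigr (fun z => u x + u z)) => [|z]; last exact: cE.
  by rewrite big_split /= sum1; have := u_eq x; lra.
move=> /edgesP[x [y [exy ->]]].
rewrite (sum_incident_edges (fun l : {set T} => \sum_(z in l) u z)) // !dE cE //; ring.
Qed.

Local Notation P := (coherent_components e).
Local Notation n := (quotient_degree e).

Lemma quotient_sum (x : T) A (F : {set T} -> R) : A \in P -> x \in A ->
  \sum_(y | e x y) F (pblock P y) = \sum_(B in P) (n A B)%:R * F B.
Proof.
move=> AP xA; have Ppart := coherent_partition e_sym e_irr.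
have [/eqP covP tP _] := and3P Ppart.
rewrite (eq_bigl (fun y => (y \in [set: T]) && e x y)); last by move=> y; rewrite in_setT.
rewrite (set_partition_big_cond _ Ppart) /=; apply: eq_bigr => B BP.
rewrite (eq_bigr (fun=> F B)) => [|y /andP[yB _]]; last by rewrite (def_pblock tP BP yB).
rewrite sumr_const mulr_natl; congr (_ *+ _).
rewrite -(quotient_degreeE e_sym e_irr AP BP xA).
by apply: eq_card => y; rewrite !inE.
Qed.

(** Subtracting the equations at [x] and [y] cancels the common neighbours [N] and leaves
    [(1 + #|N|) * (u x - u y) = 0], whether or not [x] and [y] are joined. *)
Lemma solution_coherent (u : T -> R) x y :
  (forall x, (1 + #|[set y | e x y]|%:R) * u x + \sum_(y | e x y) u y = 1) ->
  coherent e x y -> u x = u y.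
Proof.
move=> u_eq /(coherentP e_irr) twin.
have [->//|xy] := eqVneq x y.
set N := [set z | e x z] :\ y.
have NE : N = [set z | e y z] :\ x.
  apply/setP => z; rewrite !inE.
  have [->|zx] := eqVneq z x; first by rewrite e_irr andbF.
  by have [->|zy] := eqVneq z y; [rewrite e_irr | rewrite /= twin].
have cx : #|[set z | e x z]| = (e x y + #|N|)%N by rewrite (cardsD1 y) inE.
have cy : #|[set z | e y z]| = (e x y + #|N|)%N.
  by rewrite (cardsD1 x) inE e_sym -NE.
have sx : \sum_(z | e x z) u z = (e x y)%:R * u y + \sum_(z in N) u z.
  case: (boolP (e x y)) => exy.
    rewrite (bigD1 y) //= mul1r; congr (_ + _).
    by apply: eq_bigl => z; rewrite !inE andbC.
  rewrite mul0r add0r; apply: eq_bigl => z; rewrite !inE.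
  by case: eqVneq => // ->; rewrite (negPf exy).
have sy : \sum_(z | e y z) u z = (e x y)%:R * u x + \sum_(z in N) u z.
  rewrite NE e_sym; case: (boolP (e y x)) => eyx.
    rewrite (bigD1 x) //= mul1r; congr (_ + _).
    by apply: eq_bigl => z; rewrite !inE andbC.
  rewrite mul0r add0r; apply: eq_bigl => z; rewrite !inE.
  by case: eqVneq => // ->; rewrite (negPf eyx).
have := etrans (u_eq x) (esym (u_eq y)); rewrite sx sy cx cy natrD => /eqP.
rewrite -subr_eq0.
rewrite (_ : _ - _ = (1 + #|N|%:R) * (u x - u y)); last by ring.
rewrite mulf_eq0 subr_eq0 => /orP[|/eqP//].
by rewrite paddr_eq0 // oner_eq0.
Qed.

(** A solution descends by [solution_coherent], and a quotient solution is pulled back along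
    [pblock]. The guard [0 < n A B] says that an edge runs from [A] to [B]; for [A = B] it selects
    the black components. *)
Lemma positive_graph_quotient :
  positive_graph e R <->
  exists u : {set T} -> R,
    (forall A, A \in P ->
       (1 + \sum_(B in P) (n A B)%:R) * u A + \sum_(B in P) (n A B)%:R * u B = 1) /\
    (forall A B, A \in P -> B \in P -> (0 < n A B)%N -> 0 < u A + u B).
Proof.
have Ppart := coherent_partition e_sym e_irr.
have [/eqP covP tP _] := and3P Ppart.
have degE x A : A \in P -> x \in A ->
    #|[set y | e x y]|%:R = \sum_(B in P) (n A B)%:R :> R.
  move=> AP xA.
  rewrite -[RHS](eq_bigr _ (fun B _ => mulr1 _)) -(quotient_sum (fun=> 1) AP xA).
  by rewrite sumr_const; congr (_ *+ _); apply: eq_card => y; rewrite inE.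
have blockP x : pblock P x \in P by rewrite pblock_mem // covP.
have blockx x : x \in pblock P x by rewrite mem_pblock covP.
rewrite positive_graphP; split=> [[u [u_eq u_gt0]]|[u [u_eq u_gt0]]].
  pose U (A : {set T}) := if [pick x in A] is Some x then u x else 0.
  have UE A x : A \in P -> x \in A -> U A = u x.
    rewrite /U => AP xA; case: pickP => [z zA|/(_ x)]; last by rewrite xA.
    apply: solution_coherent u_eq _.
    by rewrite -(coherent_component_coherent e_sym e_irr _ AP zA).
  exists U; split=> [A AP|A B AP BP].
    have [x xA] := set0Pn _ (coherent_component_neq0 e_sym e_irr AP).
    rewrite -(quotient_sum U AP xA) -(degE x A) // (UE _ x) // -[RHS](u_eq x).
    by congr (_ + _); apply: eq_bigr => y _; apply: UE.
  have [x xA] := set0Pn _ (coherent_component_neq0 e_sym e_irr AP).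
  rewrite -(quotient_degreeE e_sym e_irr AP BP xA) => /card_gt0P[y].
  by rewrite inE => /andP[yB exy]; rewrite (UE A x) // (UE B y) // u_gt0.
exists (fun x => u (pblock P x)); split=> [x|x y exy].
  by rewrite (degE x (pblock P x)) // (quotient_sum u (blockP x)) // u_eq.
apply: u_gt0 => //; rewrite -(quotient_degreeE e_sym e_irr _ _ (blockx x)) //.
by apply/card_gt0P; exists y; rewrite inE exy andbT.
Qed.

End Positivity.

(** * Explicit solution of the quotient systems *)

Section Systems.
Local Open Scope ring_scope.
Variable R : realType.

(** Here [r], [s] stand for component sizes and [k], [l] for diagonal entries, doubled because a
    component counts both in its own degree and in its own neighbour sum. The Cramer numerators
    [1 + 2l + r - s] and [1 + 2k + s - r] have a positive sum, so [a + b > 0] costs nothing. *)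
Lemma edge_system (k l r s : nat) :
  (exists a b : R,
     [/\ (1 + k%:R *+ 2 + s%:R) * a + s%:R * b = 1,
         (1 + l%:R *+ 2 + r%:R) * b + r%:R * a = 1 &
         [/\ ((0 < k)%N -> 0 < a), ((0 < l)%N -> 0 < b) & 0 < a + b]]) <->
  ((0 < k)%N -> (s <= l.*2 + r)%N) /\ ((0 < l)%N -> (r <= k.*2 + s)%N).
Proof.
(* Adding [1] turns the weak integer inequality into the strict real one that the Cramer numerators
   give. *)
have natE (x y z : nat) : (x <= y.*2 + z)%N = (0 < 1 + y%:R *+ 2 + z%:R - x%:R :> R).
  by rewrite subr_gt0 -ltnS -(ltr_nat R) -addn1 !natrD -muln2 natrM mulr_natr
             [X in _ < X]addrC addrA.
rewrite !natE; set x : R := k%:R; set y : R := l%:R; set p : R := r%:R; set q : R := s%:R.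
have [x0 y0 p0 q0] : [/\ 0 <= x, 0 <= y, 0 <= p & 0 <= q] by rewrite !ler0n.
pose D := (1 + x *+ 2) * (1 + y *+ 2) + p * (1 + x *+ 2) + q * (1 + y *+ 2).
have D_gt0 : 0 < D by rewrite /D; nra.
split=> [[a [b [Ea Eb [a0 b0 ab0]]]]|[sl rk]].
  have -> : 1 + y *+ 2 + p - q = D * a.
    have := congr1 ( *%R (1 + y *+ 2 + p)) Ea; have := congr1 ( *%R q) Eb.
    by rewrite /D; lra.
  have -> : 1 + x *+ 2 + q - p = D * b.
    have := congr1 ( *%R (1 + x *+ 2 + q)) Eb; have := congr1 ( *%R p) Ea.
    by rewrite /D; lra.
  by rewrite !pmulr_rgt0.
exists ((1 + y *+ 2 + p - q) / D), ((1 + x *+ 2 + q - p) / D).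
split; try by rewrite !mulrA -mulrDl -[RHS](divff (lt0r_neq0 D_gt0));
  congr (_ / _); rewrite /D; ring.
split=> [/sl h|/rk h|]; try by rewrite divr_gt0.
by rewrite -mulrDl divr_gt0 //; lra.
Qed.

(** Isolating the sum [p * a + q * b + m * c] makes the system diagonal: [A * a], [B * b] and
    [C * c] all equal one number [E], which ties the signs of the unknowns to those of [A], [B],
    [C]. *)
Lemma triangle_system (k r s t : nat) :
  (exists a b c : R,
     [/\ (1 + s%:R + t%:R) * a + s%:R * b + t%:R * c = 1,
         (1 + r%:R + t%:R) * b + r%:R * a + t%:R * c = 1,
         (1 + k%:R *+ 2 + r%:R + s%:R) * c + r%:R * a + s%:R * b = 1 &
         [/\ ((0 < k)%N -> 0 < c), 0 < a + b, 0 < b + c & 0 < a + c]]) <->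
  [/\ (r <= s + t)%N, (s <= r + t)%N & (t <= k.*2 + r + s)%N].
Proof.
have natE (x y z : nat) : (x <= y + z)%N = (0 < 1 + y%:R + z%:R - x%:R :> R).
  by rewrite subr_gt0 -ltnS -(ltr_nat R) -addn1 !natrD [X in _ < X]addrC addrA.
rewrite !natE natrD -muln2 natrM mulr_natr.
set x : R := k%:R; set p : R := r%:R; set q : R := s%:R; set m : R := t%:R.
have [x0 p0 q0 m0] : [/\ 0 <= x, 0 <= p, 0 <= q & 0 <= m] by rewrite !ler0n.
set A := 1 + q + m - p; set B := 1 + p + m - q; set C := 1 + (x *+ 2 + p) + q - m.
have AB : 0 < A + B by rewrite /A /B; lra.
have AC : 0 < A + C by rewrite /A /C; lra.
have BC : 0 < B + C by rewrite /B /C; lra.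
split=> [[a [b [c [Ea Eb Ec [_ ab bc ac]]]]]|[A0 B0 C0]].
  pose E := 1 - (p * a + q * b + m * c).
  have {}Ea : A * a = E by rewrite /A /E; lra.
  have {}Eb : B * b = E by rewrite /B /E; lra.
  have {}Ec : C * c = E by rewrite /C /E; lra.
  (* Two of [A], [B], [C] are positive since pairwise sums are; a nonpositive
     third one would give its unknown the wrong sign. *)
  have key X Y Z u v w : 0 < X + Y -> 0 < X + Z -> 0 < Y + Z -> X * u = E ->
      Y * v = E -> Z * w = E -> 0 < u + v -> 0 < v + w -> 0 < X.
    move=> XY XZ YZ Eu Ev Ew uv vw; rewrite ltNge; apply/negP => X0.
    have Y0 : 0 < Y by lra.
    have Z0 : 0 < Z by lra.
    have E0 : 0 < E.
      rewrite -(pmulr_rgt0 _ YZ) (_ : _ * E = Y * Z * (v + w)) ?mulr_gt0 //.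
      by rewrite mulrDl -{1}Ew -Ev; ring.
    have : 0 < X * Y * (u + v).
      rewrite (_ : _ * (u + v) = (X + Y) * E) ?mulr_gt0 //.
      by rewrite mulrDl -{1}Ev -Eu; ring.
    by apply/negP; rewrite -leNgt; apply: mulr_le0_ge0 (ltW uv); apply: mulr_le0_ge0 (ltW Y0).
  split.
  - exact: (key A B C a b c).
  - by apply: (key B A C b a c) => //; lra.
  - by apply: (key C A B c a b) => //; lra.
(* [D] is the determinant of the diagonal matrix of [A], [B], [C] plus the rank-one matrix with rows
   [(p, q, m)]; the common value [E] becomes [A * B * C / D]. *)
pose D := A * B * C + p * B * C + q * A * C + m * A * B.
have D_gt0 : 0 < D.
  by rewrite /D !ltr_wpDr ?mulr_gt0 // ?mulr_ge0 ?(ltW A0) ?(ltW B0) ?(ltW C0).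
exists (B * C / D), (A * C / D), (A * B / D).
have pos X Y : 0 < X -> 0 < Y -> 0 < X * Y / D.
  by move=> X0 Y0; rewrite divr_gt0 // mulr_gt0.
split; last by split=> *; rewrite ?addr_gt0 // pos.
all: rewrite !mulrA -!mulrDl -[RHS](divff (lt0r_neq0 D_gt0)); congr (_ / _).
all: by rewrite /D /A /B /C; ring.
Qed.

(** The four conditions are, in order, positivity of the end unknowns [a] and [c], of the middle one
    [b], of [a + b] and of [b + c]. The ends share one condition because both are positive multiples
    of [V], whose sign is that of [M - q]. *)
Lemma path_system (k l m r s t : nat) :
  (exists a b c : R,
     [/\ (1 + k%:R *+ 2 + s%:R) * a + s%:R * b = 1,
         (1 + l%:R *+ 2 + r%:R + t%:R) * b + r%:R * a + t%:R * c = 1,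
         (1 + m%:R *+ 2 + s%:R) * c + s%:R * b = 1 &
         [/\ ((0 < k)%N -> 0 < a), ((0 < l)%N -> 0 < b), ((0 < m)%N -> 0 < c),
             0 < a + b & 0 < b + c]]) <->
  [/\ ((0 < k)%N || (0 < m)%N -> (s <= l.*2 + r + t)%N),
      ((0 < l)%N -> (r * (1 + m.*2 + s) + t * (1 + k.*2 + s) <
                     (1 + k.*2 + s) * (1 + m.*2 + s))%N),
      (t * k < (1 + l + k) * (1 + m.*2 + s) + t * m)%N &
      (r * m < (1 + l + m) * (1 + k.*2 + s) + r * k)%N].
Proof.
have dblE n : n.*2%:R = n%:R *+ 2 :> R by rewrite -muln2 natrM mulr_natr.
have sE : (s <= l.*2 + r + t)%N = (s%:R < 1 + l%:R *+ 2 + r%:R + t%:R :> R).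
  by rewrite -ltnS -(ltr_nat R) -add1n !natrD dblE !addrA.
rewrite sE -[(_ < (1 + k.*2 + s) * _)%N](ltr_nat R).
rewrite -[(t * k < _)%N](ltr_nat R) -[(r * m < _)%N](ltr_nat R).
rewrite !(natrD, natrM, dblE) {sE}.
move: (ler0n R k) (ler0n R l) (ler0n R m) (ler0n R r) (ler0n R s) (ler0n R t).
set x : R := k%:R; set y : R := l%:R; set z : R := m%:R.
set p : R := r%:R; set q : R := s%:R; set o : R := t%:R => x0 y0 z0 p0 q0 o0.
set P := 1 + x *+ 2 + q; set Q := 1 + z *+ 2 + q; set M := 1 + y *+ 2 + p + o.
have P_gt0 : 0 < P by rewrite /P; lra.
have Q_gt0 : 0 < Q by rewrite /Q; lra.
(* [D], [N] and [V] are the determinant and the numerators given by Cramer's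
   rule; writing [D] in this form shows that it is positive. *)
pose D := (1 + y *+ 2) * (P * Q) + p * Q * (1 + x *+ 2) + o * P * (1 + z *+ 2).
have D_gt0 : 0 < D.
  by rewrite /D !ltr_wpDr ?mulr_gt0 // ?mulr_ge0 //; lra.
pose N := P * Q - (p * Q + o * P).
pose V := D - q * N.
have VE : V = P * Q * (M - q) by rewrite /V /N /D /P /Q /M; ring.
have sol a b c : P * a + q * b = 1 -> M * b + p * a + o * c = 1 ->
    Q * c + q * b = 1 -> [/\ b = N / D, a = V / (P * D) & c = V / (Q * D)].
  move=> Ea Eb Ec; have bE : b = N / D.
    apply: (canRL (mulfK (lt0r_neq0 D_gt0))).
    (* Taking [P * Q] times the middle equation minus [p * Q] and [o * P] times the outer ones
       leaves [D * b = N]. *)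
    have := congr1 ( *%R (p * Q)) Ea; have := congr1 ( *%R (P * Q)) Eb.
    have := congr1 ( *%R (o * P)) Ec.
    by rewrite /N /D /P /Q /M; lra.
  split=> //.
    apply: (mulfI (lt0r_neq0 P_gt0)); rewrite (_ : P * a = 1 - q * b); last by lra.
    by rewrite bE /V; field; rewrite !lt0r_neq0.
  apply: (mulfI (lt0r_neq0 Q_gt0)); rewrite (_ : Q * c = 1 - q * b); last by lra.
  by rewrite bE /V; field; rewrite !lt0r_neq0.
have solE : [/\ P * (V / (P * D)) + q * (N / D) = 1,
    M * (N / D) + p * (V / (P * D)) + o * (V / (Q * D)) = 1 &
    Q * (V / (Q * D)) + q * (N / D) = 1].
  split.
  - by rewrite /V; field; rewrite !lt0r_neq0.
  - transitivity ((M * N + (p * Q + o * P) * (M - q)) / D).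
      by rewrite VE; field; rewrite !lt0r_neq0.
    rewrite -[RHS](divff (lt0r_neq0 D_gt0)); congr (_ / _).
    by rewrite /N /D /P /Q /M; ring.
  - by rewrite /V; field; rewrite !lt0r_neq0.
have aE : (0 < V / (P * D)) = (q < M).
  by rewrite pmulr_lgt0 ?invr_gt0 ?mulr_gt0 // VE pmulr_rgt0 ?mulr_gt0 // subr_gt0.
have cE : (0 < V / (Q * D)) = (q < M).
  by rewrite pmulr_lgt0 ?invr_gt0 ?mulr_gt0 // VE pmulr_rgt0 ?mulr_gt0 // subr_gt0.
have bE : (0 < N / D) = (p * Q + o * P < P * Q).
  by rewrite pmulr_lgt0 ?invr_gt0 // subr_gt0.
have abE : (0 < V / (P * D) + N / D) = (o * x < (1 + y + x) * Q + o * z).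
  (* Over [P * D] the sum has numerator [V + P * N], which is this left-hand side; the factor [P]
     then cancels. *)
  have num : D + (1 + x *+ 2) * N = 2 * P * ((1 + y + x) * Q + o * z - o * x).
    by rewrite /N /D /P /Q; ring.
  have -> : V / (P * D) + N / D = ((1 + y + x) * Q + o * z - o * x) * (2 / D).
    transitivity ((D + (1 + x *+ 2) * N) / (P * D)).
      by rewrite /V (_ : 1 + x *+ 2 = P - q); [field; rewrite !lt0r_neq0 | rewrite /P; ring].
    by rewrite num; field; rewrite !lt0r_neq0.
  by rewrite pmulr_lgt0 ?divr_gt0 // subr_gt0.
have bcE : (0 < N / D + V / (Q * D)) = (p * z < (1 + y + z) * P + p * x).
  have num : D + (1 + z *+ 2) * N = 2 * Q * ((1 + y + z) * P + p * x - p * z).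
    by rewrite /N /D /P /Q; ring.
  have -> : N / D + V / (Q * D) = ((1 + y + z) * P + p * x - p * z) * (2 / D).
    transitivity ((D + (1 + z *+ 2) * N) / (Q * D)).
      by rewrite /V (_ : 1 + z *+ 2 = Q - q); [field; rewrite !lt0r_neq0 | rewrite /Q; ring].
    by rewrite num; field; rewrite !lt0r_neq0.
  by rewrite pmulr_lgt0 ?divr_gt0 // subr_gt0.
split=> [[a [b [c [Ea Eb Ec]]]]|[h1 h2 h3 h4]].
  have [-> -> ->] := sol a b c Ea Eb Ec; rewrite aE bE cE abE bcE.
  by case=> ka lb mc -> ->; split=> // /orP[].
exists (V / (P * D)), (N / D), (V / (Q * D)); have [-> -> ->] := solE.
rewrite aE bE cE abE bcE; split=> //; split=> // h; apply: h1; rewrite h ?orbT //.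
Qed.

End Systems.

(** * Positivity criteria for two and three components in terms of their sizes *)

Section Blocks.
Variables (T : finType) (e : rel T).
Hypotheses (e_sym : symmetric e) (e_irr : irreflexive e).
Local Notation P := (coherent_components e).
Local Notation n := (quotient_degree e).

Lemma three_componentsP (A B C : {set T}) : three_components e A B C ->
  [/\ A != B, A != C, B != C & P = [set A; B; C]].
Proof. by case; rewrite /= !inE negb_or andbT => /andP[/andP[-> ->] ->]. Qed.

Lemma big_three (V : nmodType) (A B C : {set T}) (F : {set T} -> V) :
  three_components e A B C ->
  (\sum_(X in P) F X = F A + F B + F C)%R.
Proof.
move=> /three_componentsP[AB AC BC ->].
by rewrite -setUA !big_setU1 ?big_set1 ?inE ?negb_or ?AB ?AC ?BC //= addrA.
Qed.

Lemma three_components_neq0 (A B C : {set T}) : three_components e A B C ->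
  [/\ A != set0, B != set0 & C != set0].
Proof.
case/three_componentsP=> _ _ _ PE.
by split; apply: (coherent_component_neq0 e_sym e_irr);
  rewrite PE !inE eqxx ?orbT.
Qed.

Lemma two_adjacent_positive (R : realType) (A B : {set T}) : two_adjacent e A B ->
  positive_graph e R <->
  (0 < n A A -> #|B| <= (n B B).*2 + #|A|) /\
  (0 < n B B -> #|A| <= (n A A).*2 + #|B|).
Proof.
move=> [AB PE adjAB].
have [A0 B0] : A != set0 /\ B != set0.
  by split; apply: (coherent_component_neq0 e_sym e_irr); rewrite PE !inE eqxx ?orbT.
have nAB : quotient_degree e A B = #|B| by rewrite quotient_degree_adjacent.
have nBA : quotient_degree e B A = #|A|.
  by rewrite quotient_degree_adjacent //; apply: adjacent_sym.
have sumE (F : {set T} -> R) : (\sum_(X in coherent_components e) F X = F A + F B)%R.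
  by rewrite PE big_setU1 ?inE // big_set1.
have cA : 0 < #|A| by rewrite card_gt0.
have cB : 0 < #|B| by rewrite card_gt0.
rewrite -(edge_system R) positive_graph_quotient //.
split=> [[u [u_eq u_gt0]]|[a [b [Ea Eb [a0 b0 ab0]]]]].
  have memA : A \in coherent_components e by rewrite PE !inE eqxx.
  have memB : B \in coherent_components e by rewrite PE !inE eqxx orbT.
  exists (u A), (u B); move: (u_eq _ memA) (u_eq _ memB).
  rewrite !sumE nAB nBA => EA EB; split; [rewrite -[RHS]EA; ring | rewrite -[RHS]EB; ring |].
  split=> [h|h|]; last by rewrite u_gt0 // nAB.
    by have := u_gt0 _ _ memA memA h; lra.
  by have := u_gt0 _ _ memB memB h; lra.
exists (fun X => if X == A then a else b); split=> [X|X Y].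
  rewrite !sumE PE !inE eqxx [B == A]eq_sym (negPf AB) => /orP[]/eqP->.
    by rewrite eqxx nAB -[RHS]Ea; ring.
  by rewrite [B == A]eq_sym (negPf AB) nBA -[RHS]Eb; ring.
rewrite PE !inE => /orP[]/eqP-> /orP[]/eqP->; rewrite ?eqxx ?[B == A]eq_sym ?(negPf AB) => h.
- by rewrite addr_gt0 // a0.
- by [].
- by rewrite addrC.
- by rewrite addr_gt0 // b0.
Qed.

(** The entries stay symbolic so that triangle and path are both instances; the guards are
    disjunctions because the quotient criterion covers each pair in both orders. *)
Lemma three_components_positive (R : realType) (A B C : {set T}) :
  three_components e A B C ->
  positive_graph e R <->
  exists a b c : R,
    [/\ (1 + (n A A)%:R *+ 2 + (n A B)%:R + (n A C)%:R) * a
          + (n A B)%:R * b + (n A C)%:R * c = 1,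
        (1 + (n B B)%:R *+ 2 + (n B A)%:R + (n B C)%:R) * b
          + (n B A)%:R * a + (n B C)%:R * c = 1,
        (1 + (n C C)%:R *+ 2 + (n C A)%:R + (n C B)%:R) * c
          + (n C A)%:R * a + (n C B)%:R * b = 1 &
        [/\ [/\ (0 < n A A)%N -> 0 < a, (0 < n B B)%N -> 0 < b & (0 < n C C)%N -> 0 < c],
            (0 < n A B)%N || (0 < n B A)%N -> 0 < a + b,
            (0 < n B C)%N || (0 < n C B)%N -> 0 < b + c &
            (0 < n A C)%N || (0 < n C A)%N -> 0 < a + c]]%R.
Proof.
move=> ABC; have sumE F := big_three (V := R) F ABC.
have [AB AC BC PE] := three_componentsP ABC.
have memA : A \in coherent_components e by rewrite PE !inE eqxx.
have memB : B \in coherent_components e by rewrite PE !inE eqxx orbT.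
have memC : C \in coherent_components e by rewrite PE !inE eqxx orbT.
rewrite positive_graph_quotient //.
split=> [[u [u_eq u_gt0]]|[a [b [c [Ea Eb Ec [[a0 b0 c0] ab bc ac]]]]]].
  exists (u A), (u B), (u C); move: (u_eq _ memA) (u_eq _ memB) (u_eq _ memC).
  rewrite !sumE => EA EB EC; split.
  - by rewrite -[RHS]EA; ring.
  - by rewrite -[RHS]EB; ring.
  - by rewrite -[RHS]EC; ring.
  split; first split.
  - by move=> h; have := u_gt0 _ _ memA memA h; lra.
  - by move=> h; have := u_gt0 _ _ memB memB h; lra.
  - by move=> h; have := u_gt0 _ _ memC memC h; lra.
  - by case/orP => h; [|rewrite addrC]; apply: u_gt0.
  - by case/orP => h; [|rewrite addrC]; apply: u_gt0.
  - by case/orP => h; [|rewrite addrC]; apply: u_gt0.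
pose u X := if X == A then a else if X == B then b else c.
have uA : u A = a by rewrite /u eqxx.
have uB : u B = b by rewrite /u [B == A]eq_sym (negPf AB) eqxx.
have uC : u C = c by rewrite /u [C == A]eq_sym (negPf AC) [C == B]eq_sym (negPf BC).
exists u; split=> [X|X Y].
  rewrite !sumE uA uB uC PE !inE -orbA => /or3P[]/eqP->.
  - by rewrite uA -[RHS]Ea; ring.
  - by rewrite uB -[RHS]Eb; ring.
  - by rewrite uC -[RHS]Ec; ring.
rewrite PE !inE -!orbA => /or3P[]/eqP-> /or3P[]/eqP->; rewrite ?uA ?uB ?uC => h.
- by rewrite addr_gt0 // a0.
- by rewrite ab // h.
- by rewrite ac // h.
- by rewrite addrC ab // h orbT.
- by rewrite addr_gt0 // b0.
- by rewrite bc // h.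
- by rewrite addrC ac // h orbT.
- by rewrite addrC bc // h orbT.
- by rewrite addr_gt0 // c0.
Qed.

Lemma three_path_positive (R : realType) (A B C : {set T}) : three_path e A B C ->
  let k := n A A in let l := n B B in let m := n C C in
  let r := #|A| in let s := #|B| in let t := #|C| in
  positive_graph e R <->
  [/\ ((0 < k) || (0 < m) -> s <= l.*2 + r + t),
      (0 < l -> r * (1 + m.*2 + s) + t * (1 + k.*2 + s) <
                (1 + k.*2 + s) * (1 + m.*2 + s)),
      t * k < (1 + l + k) * (1 + m.*2 + s) + t * m &
      r * m < (1 + l + m) * (1 + k.*2 + s) + r * k].
Proof.
move=> [ABC adjAB adjBC nadjAC] k l m r s t.
have [A0 B0 C0] := three_components_neq0 ABC.
rewrite (three_components_positive R ABC) -(path_system R).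
have nAB : n A B = s by apply: quotient_degree_adjacent.
have nBC : n B C = t by apply: quotient_degree_adjacent.
have nBA : n B A = r by apply: quotient_degree_adjacent => //; apply: adjacent_sym.
have nCB : n C B = s by apply: quotient_degree_adjacent => //; apply: adjacent_sym.
have nAC : n A C = 0 by apply: quotient_degree_nonadjacent.
have nCA : n C A = 0 by apply: quotient_degree_nonadjacent; apply: nonadjacent_sym.
(* A nonempty middle component makes the guards of both adjacent pairs true; the zero entries
   between the ends discard the last guard. *)
have s0 : 0 < s by rewrite card_gt0.
rewrite nAB nBC nBA nCB nAC nCA -/k -/l -/m s0 !orbT /=.
split=> -[a [b [c]]]; rewrite !(mul0r, addr0).
  move=> [Ea Eb Ec [[a0 b0 c0] ab bc _]]; exists a, b, c; split=> //.
  by split=> //; [exact: ab|exact: bc].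
move=> [Ea Eb Ec [a0 b0 c0 ab bc]]; exists a, b, c; rewrite !(mul0r, addr0).
by split.
Qed.

Lemma three_pairwise_positive (R : realType) (A B C : {set T}) :
  three_pairwise_adjacent e A B C -> white e A -> white e B ->
  positive_graph e R <->
  [/\ #|A| <= #|B| + #|C|, #|B| <= #|A| + #|C| & #|C| <= (n C C).*2 + #|A| + #|B|].
Proof.
move=> [ABC adjAB adjBC adjAC] wA wB.
have [A0 B0 C0] := three_components_neq0 ABC.
rewrite (three_components_positive R ABC) -(triangle_system R).
have -> : n A B = #|B| by apply: quotient_degree_adjacent.
have -> : n B C = #|C| by apply: quotient_degree_adjacent.
have -> : n A C = #|C| by apply: quotient_degree_adjacent.
have -> : n B A = #|A| by apply: quotient_degree_adjacent => //; apply: adjacent_sym.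
have -> : n C B = #|B| by apply: quotient_degree_adjacent => //; apply: adjacent_sym.
have -> : n C A = #|A| by apply: quotient_degree_adjacent => //; apply: adjacent_sym.
have -> : n A A = 0 by apply: quotient_degree_white.
have -> : n B B = 0 by apply: quotient_degree_white.
have cA : 0 < #|A| by rewrite card_gt0.
have cB : 0 < #|B| by rewrite card_gt0.
rewrite cA cB !orbT.
split=> -[a [b [c]]]; rewrite !(mulr0n, mul0rn, addr0).
  move=> [Ea Eb Ec [[_ _ c0] ab bc ac]]; exists a, b, c; split=> //.
  by split; [|exact: ab|exact: bc|exact: ac].
move=> [Ea Eb Ec [c0 ab bc ac]]; exists a, b, c.
by split=> //; split.
Qed.

End Blocks.

(** * Classification of the graphs with at most three components *)

Section Classification.
Variables (T : finType) (e : rel T).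
Hypotheses (e_sym : symmetric e) (e_irr : irreflexive e).
Local Notation P := (coherent_components e).

(** A tool for excluding colour patterns: the components cover the vertices, so being twins can be
    checked component by component. *)
Lemma component_eq_of_twins A B x y : A \in P -> B \in P -> x \in A -> y \in B ->
  (forall C, C \in P -> {in C, forall z, z != x -> z != y -> e x z = e y z}) ->
  A = B.
Proof.
move=> AP BP xA yB twin; apply: (coherent_component_disjoint e_sym e_irr AP BP (x := y)) => //.
rewrite (coherent_component_coherent e_sym e_irr _ AP xA).
apply/(coherentP e_irr) => z.
have [/eqP covP _ _] := and3P (coherent_partition e_sym e_irr).
have : z \in cover P by rewrite covP inE.
by move=> /bigcupP[C CP zC]; exact: (twin C CP z zC).
Qed.

(** A vertex of [A] and one of [B] are both joined to everything else, hence are twins. *)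
Lemma adjacent_black_eq A B : A \in P -> B \in P -> black e A -> black e B ->
  adjacent e A B ->
  (forall C, C \in P -> C != A -> C != B ->
     adjacent e A C /\ adjacent e B C) ->
  A = B.
Proof.
move=> AP BP [_ bA] [_ bB] AB other.
have [x xA] := set0Pn _ (coherent_component_neq0 e_sym e_irr AP).
have [y yB] := set0Pn _ (coherent_component_neq0 e_sym e_irr BP).
apply: (component_eq_of_twins AP BP xA yB) => C CP z zC zx zy.
have [CA|CA] := eqVneq C A.
  by rewrite CA in zC; rewrite [e y z]e_sym (AB z y) // (bA x z) // eq_sym.
have [CB|CB] := eqVneq C B.
  by rewrite CB in zC; rewrite (AB x z) // (bB y z) // eq_sym.
by have [adjAC adjBC] := other _ CP CA CB; rewrite adjAC // adjBC.
Qed.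

Hypothesis e_conn : connected_graph e.

(** If no edge left [S], it would be closed under [e], hence under [connect e], and could not
    separate [x] from [y]. *)
Lemma connected_cut (S : {set T}) x y : x \in S -> y \notin S ->
  exists a b, [/\ a \in S, b \notin S & e a b].
Proof.
move=> xS yS.
case: (boolP [exists a in S, exists b in ~: S, e a b]) => [|nab].
  move=> /exists_inP[a aS /exists_inP[b]]; rewrite inE => bS eab.
  by exists a, b.
have cl : closed e (mem S).
  apply: (intro_closed (sym_connect_sym e_sym)) => a b eab aS /=.
  apply: contraNT nab => bS.
  by apply/exists_inP; exists a => //; apply/exists_inP; exists b; rewrite // inE.
have [_ /(_ x y) cxy] := e_conn.
by have := closed_connect cl cxy; rewrite xS (negPf yS).
Qed.

(** Connectivity gives an edge leaving [A], and one edge between distinct components already makes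
    them adjacent. *)
Lemma component_has_adjacent A B : A \in P -> B \in P -> A != B ->
  exists C, [/\ C \in P, C != A & adjacent e A C].
Proof.
move=> AP BP AB.
have [x xA] := set0Pn _ (coherent_component_neq0 e_sym e_irr AP).
have [y yB] := set0Pn _ (coherent_component_neq0 e_sym e_irr BP).
have yA : y \notin A.
  apply: contraNN AB => yA.
  by rewrite (coherent_component_disjoint e_sym e_irr AP BP yA).
have [a [b [aA bA eab]]] := connected_cut xA yA.
have [/eqP covP _ _] := and3P (coherent_partition e_sym e_irr).
have : b \in cover P by rewrite covP inE.
move=> /bigcupP[C CP bC]; have CA : C != A by apply: contraNneq bA => <-.
exists C; split=> //; rewrite eq_sym in CA.
have [//|nAC] := component_adjacentVnonadjacent e_sym e_irr AP CP CA.
by have := nAC _ _ aA bC; rewrite eab.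
Qed.

Lemma adjacent_nonadjacentF A B : A \in P -> B \in P ->
  adjacent e A B -> nonadjacent e A B -> False.
Proof.
move=> AP BP adj nadj.
have [x xA] := set0Pn _ (coherent_component_neq0 e_sym e_irr AP).
have [y yB] := set0Pn _ (coherent_component_neq0 e_sym e_irr BP).
by have := nadj _ _ xA yB; rewrite adj.
Qed.

Lemma three_components_swap12 A B C : three_components e A B C -> three_components e B A C.
Proof.
move=> ABC; have [AB neqAC BC PE] := three_componentsP ABC; split.
  by rewrite /= !inE negb_or eq_sym AB neqAC BC.
by rewrite PE; congr (_ :|: _); rewrite setUC.
Qed.

Lemma three_components_swap23 A B C : three_components e A B C -> three_components e A C B.
Proof.
move=> ABC; have [AB neqAC BC PE] := three_componentsP ABC; split.
  by rewrite /= !inE negb_or [C == B]eq_sym AB neqAC BC.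
by rewrite PE setUAC.
Qed.

Lemma three_components_mem A B C : three_components e A B C ->
  [/\ A \in P, B \in P & C \in P].
Proof. by case/three_componentsP=> _ _ _ ->; rewrite !inE !eqxx ?orbT. Qed.

Lemma three_pairwise_swap12 A B C :
  three_pairwise_adjacent e A B C -> three_pairwise_adjacent e B A C.
Proof.
case=> /three_components_swap12 ABC AB BC neqAC; split=> //.
exact: adjacent_sym.
Qed.

Lemma three_pairwise_swap23 A B C :
  three_pairwise_adjacent e A B C -> three_pairwise_adjacent e A C B.
Proof.
case=> /three_components_swap23 ABC AB BC neqAC; split=> //.
exact: adjacent_sym.
Qed.

Lemma three_path_rev A B C : three_path e A B C -> three_path e C B A.
Proof.
case=> ABC AB BC neqAC; split; try exact: adjacent_sym; try exact: nonadjacent_sym.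
by apply/three_components_swap12/three_components_swap23/three_components_swap12.
Qed.

Lemma three_pairwise_black12F A B C :
  three_pairwise_adjacent e A B C -> black e A -> black e B -> False.
Proof.
move=> [ABC adjAB adjBC adjAC] bA bB.
have [AP BP CP] := three_components_mem ABC.
have [/eqP AB _ _ PE] := three_componentsP ABC; apply: AB.
apply: adjacent_black_eq => // D; rewrite PE !inE.
by move=> /orP[/orP[]|] /eqP-> //; rewrite eqxx.
Qed.

(** Vertices of both ends would have exactly [B] as neighbourhood, so they would be twins. *)
Lemma three_path_white13F A B C :
  three_path e A B C -> white e A -> white e C -> False.
Proof.
move=> [ABC adjAB adjBC nadjAC] wA wC.
have [AP BP CP] := three_components_mem ABC.
have [_ /eqP neqAC _ PE] := three_componentsP ABC; apply: neqAC.
have [x xA] := set0Pn _ (coherent_component_neq0 e_sym e_irr AP).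
have [y yC] := set0Pn _ (coherent_component_neq0 e_sym e_irr CP).
apply: (component_eq_of_twins AP CP xA yC) => D DP z zD _ _.
move: DP; rewrite PE !inE => /orP[/orP[]|] /eqP DE; rewrite DE in zD.
- by rewrite (negPf (wA _ _ xA zD)) e_sym (negPf (nadjAC _ _ zD yC)).
- by rewrite adjAB // e_sym adjBC.
- by rewrite (negPf (nadjAC _ _ xA zD)) (negPf (wC _ _ yC zD)).
Qed.

(** Of the eight adjacency patterns, the four with at most one adjacent pair isolate a component,
    against connectivity; two adjacent pairs give a path through the component they share. *)
Lemma three_componentsVpath A B C : three_components e A B C ->
  [\/ three_pairwise_adjacent e A B C, three_path e A B C,
      three_path e B A C | three_path e A C B].
Proof.
move=> ABC; have [AB neqAC BC PE] := three_componentsP ABC.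
have [AP BP CP] := three_components_mem ABC.
have BA : B != A by rewrite eq_sym.
have CA : C != A by rewrite eq_sym.
have CB : C != B by rewrite eq_sym.
have adj2 X Y : X \in P -> Y \in P -> X != Y ->
    adjacent e X Y /\ adjacent e Y X \/ nonadjacent e X Y /\ nonadjacent e Y X.
  move=> XP YP XY.
  by have [adj|nadj] := component_adjacentVnonadjacent e_sym e_irr XP YP XY;
    [left|right]; split=> //; [apply: adjacent_sym|apply: nonadjacent_sym].
have not2 X Y Z : X \in P -> Y \in P -> Z \in P -> X != Y -> P = [set X; Y; Z] ->
    nonadjacent e X Y -> nonadjacent e X Z -> False.
  move=> XP YP ZP XY PE' nXY nXZ.
  have [D [DP DX adjD]] := component_has_adjacent XP YP XY.
  move: (DP); rewrite PE' !inE (negPf DX) /= => /orP[]/eqP DE; subst D.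
    exact: (adjacent_nonadjacentF XP YP).
  exact: (adjacent_nonadjacentF XP ZP).
have PEB : P = [set B; A; C] by have [] := three_components_swap12 ABC.
have PEC : P = [set C; A; B].
  by have [] := three_components_swap12 (three_components_swap23 ABC).
have [[ab ba]|[nab nba]] := adj2 A B AP BP AB;
have [[bc cb]|[nbc ncb]] := adj2 B C BP CP BC;
have [[ac ca]|[nac nca]] := adj2 A C AP CP neqAC.
- by apply: Or41; split.
- by apply: Or42; split.
- by apply: Or43; split=> //; apply: three_components_swap12.
- by case: (not2 C A B).
- by apply: Or44; split=> //; apply: three_components_swap23.
- by case: (not2 A B C).
- by case: (not2 B A C).
- by case: (not2 A B C).
Qed.

(** The ends cannot both be white; if [C] is the white end the path is reversed, since types 6 and 7
    list the white end first. *)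
Lemma three_path_types A B C : three_path e A B C ->
  exists r s t, [/\ 1 <= r, 1 <= s & 1 <= t] /\
    [\/ type6 e r s t, type7 e r s t, type8 e r s t | type9 e r s t].
Proof.
move=> ABC; have [tc _ _ _] := ABC; have CBA := three_path_rev ABC.
have [A0 B0 C0] := three_components_neq0 e_sym e_irr tc.
have [AP BP CP] := three_components_mem tc.
have := component_whiteVblack e_sym e_irr AP.
have := component_whiteVblack e_sym e_irr BP.
have := component_whiteVblack e_sym e_irr CP.
case=> [wC|bC] [wB|bB] [wA|bA].
- by case: (three_path_white13F ABC).
- exists #|C|, #|B|, #|A|; rewrite !card_gt0; split=> //.
  by apply: Or41; exists C, B, A.
- by case: (three_path_white13F ABC).
- exists #|C|, #|B|, #|A|; rewrite !card_gt0; split=> //.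
  by apply: Or42; exists C, B, A.
- exists #|A|, #|B|, #|C|; rewrite !card_gt0; split=> //.
  by apply: Or41; exists A, B, C.
- exists #|A|, #|B|, #|C|; rewrite !card_gt0; split=> //.
  by apply: Or43; exists A, B, C.
- exists #|A|, #|B|, #|C|; rewrite !card_gt0; split=> //.
  by apply: Or42; exists A, B, C.
- exists #|A|, #|B|, #|C|; rewrite !card_gt0; split=> //.
  by apply: Or44; exists A, B, C.
Qed.

(** Two adjacent black components would merge here, so at most one is black, and a permutation puts
    it last. *)
Lemma three_pairwise_types A B C : three_pairwise_adjacent e A B C ->
  exists r s t, [/\ 1 <= r, 1 <= s & 1 <= t] /\ (type4 e r s t \/ type5 e r s t).
Proof.
move=> ABC; have [tc _ _ _] := ABC.
have ACB := three_pairwise_swap23 ABC; have BAC := three_pairwise_swap12 ABC.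
have CBA := three_pairwise_swap12 (three_pairwise_swap23 BAC).
have BCA := three_pairwise_swap23 BAC.
have [A0 B0 C0] := three_components_neq0 e_sym e_irr tc.
have [AP BP CP] := three_components_mem tc.
have := component_whiteVblack e_sym e_irr AP.
have := component_whiteVblack e_sym e_irr BP.
have := component_whiteVblack e_sym e_irr CP.
case=> [wC|bC] [wB|bB] [wA|bA]; try by [case: (three_pairwise_black12F ABC)
  |case: (three_pairwise_black12F ACB)|case: (three_pairwise_black12F BCA)].
- exists #|A|, #|B|, #|C|; rewrite !card_gt0; split=> //.
  by left; exists A, B, C.
- exists #|B|, #|C|, #|A|; rewrite !card_gt0; split=> //.
  by right; exists B, C, A.
- exists #|A|, #|C|, #|B|; rewrite !card_gt0; split=> //.
  by right; exists A, C, B.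
- exists #|A|, #|B|, #|C|; rewrite !card_gt0; split=> //.
  by right; exists A, B, C.
Qed.

Lemma two_adjacent_types A B : two_adjacent e A B ->
  exists r s, [/\ 1 <= r & 1 <= s] /\ (type2 e r s \/ type3 e r s).
Proof.
move=> [AB PE adjAB].
have AP : A \in P by rewrite PE !inE eqxx.
have BP : B \in P by rewrite PE !inE eqxx orbT.
have A0 := coherent_component_neq0 e_sym e_irr AP.
have B0 := coherent_component_neq0 e_sym e_irr BP.
have adjBA : adjacent e B A by apply: adjacent_sym.
have := component_whiteVblack e_sym e_irr AP.
have := component_whiteVblack e_sym e_irr BP.
case=> [wB|bB] [wA|bA].
- exists #|A|, #|B|; rewrite !card_gt0; split=> //.
  by left; exists A, B.
- exists #|B|, #|A|; rewrite !card_gt0; split=> //.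
  by right; exists B, A; split=> //; split; rewrite // 1?eq_sym // setUC.
- exists #|A|, #|B|; rewrite !card_gt0; split=> //.
  by right; exists A, B.
- case/eqP: AB; apply: adjacent_black_eq => // C; rewrite PE !inE.
  by move=> /orP[]/eqP->; rewrite eqxx.
Qed.

Lemma one_component_type A : P = [set A] -> type1 e #|T|.
Proof.
move=> PE; have Ppart := coherent_partition e_sym e_irr.
have AT : A = [set: T].
  by have [/eqP <- _ _] := and3P Ppart; rewrite PE /cover big_set1.
have AP : A \in P by rewrite PE inE.
rewrite AT in PE AP; split=> //.
have [wT|[]//] := component_whiteVblack e_sym e_irr AP.
move=> x y _ _ xy.
(* In the white case, connectivity would still force an edge out of [[set x]], a contradiction. *)
have [a [b [_ _ eab]]] : exists a b, [/\ a \in [set x], b \notin [set x] & e a b].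
  by apply: (@connected_cut _ x y); rewrite inE // eq_sym.
by have := wT a b (in_setT _) (in_setT _); rewrite eab.
Qed.

Lemma connected_types : #|P| <= 3 ->
  exists r s t : nat,
     [/\ 1 <= r, 1 <= s & 1 <= t] /\
     (type1 e r \/ type2 e r s \/ type3 e r s \/
      type4 e r s t \/ type5 e r s t \/ type6 e r s t \/
      type7 e r s t \/ type8 e r s t \/ type9 e r s t).
Proof.
have [T_gt0 _] := e_conn.
have [x _] := card_gt0P T_gt0.
have [/eqP covP _ _] := and3P (coherent_partition e_sym e_irr).
have : x \in cover P by rewrite covP inE.
move=> /bigcupP[A AP _]; rewrite (cardsD1 A) AP add1n ltnS.
have PE : P = A |: (P :\ A) by rewrite setD1K.
case c: #|P :\ A| => [|[|[|//]]] _.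
- have P1 : P = [set A] by rewrite PE (cards0_eq c) setU0.
  (* Padding with [1] keeps the size bounds true for the letters absent from this type. *)
  by exists #|T|, 1, 1; split=> //; left; apply: one_component_type P1.
- have /cards1P[B BE] : #|P :\ A| == 1 by rewrite c.
  have AB : A != B.
    by have : B \in P :\ A by [rewrite BE inE]; rewrite !inE eq_sym => /andP[].
  have P2 : P = [set A; B] by rewrite PE BE.
  have BP : B \in P by rewrite P2 !inE eqxx orbT.
  have [C [CP CA adjAC]] := component_has_adjacent AP BP AB.
  move: CP; rewrite P2 !inE (negPf CA) /= => /eqP CB; rewrite CB in adjAC.
  have [|r [s [[r0 s0] rs]]] := @two_adjacent_types A B; first by split.
  by exists r, s, 1; split=> //; right; case: rs; [left|right; left].
- have /cards2P[B [C [BC BCE]]] : #|P :\ A| == 2 by rewrite c.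
  have AB : A != B.
    by have : B \in P :\ A by [rewrite BCE !inE eqxx]; rewrite !inE eq_sym => /andP[].
  have neqAC : A != C.
    by have : C \in P :\ A by [rewrite BCE !inE eqxx orbT]; rewrite !inE eq_sym => /andP[].
  have tc : three_components e A B C.
    by split; [rewrite /= !inE negb_or AB neqAC BC | rewrite PE BCE setUA].
  have [/three_pairwise_types|h|h|h] := three_componentsVpath tc.
    by move=> [r [s [t [h h']]]]; exists r, s, t; split=> //; tauto.
  all: by have [r [s [t [h1 h2]]]] := three_path_types h;
    exists r, s, t; split=> //; case: h2; tauto.
Qed.

End Classification.

(** * The nine types and their positivity conditions *)

Theorem mainTheorem2 (R : realType) (T : finType) (e : rel T)
    (e_sym : symmetric e) (e_irr : irreflexive e)
    (e_conn : connected_graph e) (e_comp : #|coherent_components e| <= 3) :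
  (exists r s t : nat,
     [/\ 1 <= r, 1 <= s & 1 <= t] /\
     (type1 e r \/ type2 e r s \/ type3 e r s \/
      type4 e r s t \/ type5 e r s t \/ type6 e r s t \/
      type7 e r s t \/ type8 e r s t \/ type9 e r s t)) /\
  (forall r, type1 e r -> positive_graph e R) /\
  (forall r s, type2 e r s -> positive_graph e R) /\
  (forall r s, type3 e r s -> (positive_graph e R <-> r <= s)) /\
  (forall r s t, type4 e r s t ->
     (positive_graph e R <-> [/\ t <= r + s, r <= s + t & s <= t + r])) /\
  (forall r s t, type5 e r s t ->
     (positive_graph e R <-> (`|r%:Z - s%:Z| < 1 + t%:Z)%R)) /\
  (forall r s t, type6 e r s t ->
     (positive_graph e R <->
      (0 < r%:Z + t%:Z * (1 - r%:Z + s%:Z))%R /\ s <= t + r)) /\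
  (forall r s t, type7 e r s t ->
     (positive_graph e R <->
      ((r%:Z - 1) * (t%:Z - 1) < (s%:Z + t%:Z) * (s%:Z - r%:Z))%R)) /\
  (forall r s t, type8 e r s t -> (positive_graph e R <-> s <= r + t)) /\
  (forall r s t, type9 e r s t -> positive_graph e R).
Proof.
have whiteE := quotient_degree_white (e := e).
have blackE A : black e A -> quotient_degree e A A = #|A|.-1.
  by case=> _; apply: quotient_degree_complete.
split; first exact: connected_types.
split.
  move=> _ [PE complete _]; apply/positive_graph_quotient => //.
  pose d := quotient_degree e [set: T] [set: T].
  have d0 : (0 < 1 + d%:R *+ 2 :> R)%R by rewrite ltr_wpDr // mulrn_wge0.
  (* With one component the system is the single equation [(1 + d) * u + d * u = 1]. *)
  exists (fun=> (1 + d%:R *+ 2)^-1)%R; rewrite PE; split=> [A|A B _ _ _].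
    rewrite inE => /eqP->; rewrite !big_set1 -/d -mulrDl -[RHS](divff (lt0r_neq0 d0)).
    by congr (_ / _)%R; ring.
  by rewrite addr_gt0 // invr_gt0.
split.
  move=> r s [A [B [AB wA wB _ _]]].
  by rewrite (two_adjacent_positive e_sym e_irr R AB) !whiteE.
split.
  move=> r s [A [B [AB wA bB <- <-]]].
  rewrite (two_adjacent_positive e_sym e_irr R AB) whiteE // blackE //.
  case: bB => B2 _; split=> [[_ h]|h]; last by split.
  by have := h; lia.
split.
  move=> r s t [A [B [C [ABC [wA wB wC] [<- <- <-]]]]].
  rewrite (three_pairwise_positive e_sym e_irr R ABC) // whiteE //.
  by split=> [[? ? ?]|[? ? ?]]; split; lia.
split.
  move=> r s t [A [B [C [ABC [wA wB bC] [<- <- <-]]]]].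
  rewrite (three_pairwise_positive e_sym e_irr R ABC) // blackE //.
  case: bC => C2 _; move: C2 => {ABC}; move: #|A| #|B| #|C| => r' s' t' t2.
  (* The bound on the black size is automatic for [2 <= t']; the other two amount to
     [|r' - s'| <= t']. *)
  by split=> [[? ? ?]|?]; [lia | split; lia].
split.
  move=> r s t [A [B [C [ABC [wA wB bC] [<- <- <-]]]]].
  rewrite (three_path_positive e_sym e_irr R ABC) (whiteE A) // (whiteE B) // (blackE C) //.
  case: bC => C2 _; move: C2 => {ABC}; move: #|A| #|B| #|C| => r' s' [|t'] // t2.
  (* The [b + c] condition reads [r (t - 1) < t (1 + s)], the first stated inequality; the guard of
     [h1] holds since [t] is at least 2. *)
  rewrite /=; split=> [[h1 _ h2 h3]|[h1 h2]].
    by split; [move: h3; nia | have := h1; lia].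
  by split=> //; [lia | nia | nia].
split.
  move=> r s t [A [B [C [ABC [wA bB bC] [<- <- <-]]]]].
  rewrite (three_path_positive e_sym e_irr R ABC) (whiteE A) // !blackE //.
  case: bB bC => B2 _ [C2 _]; move: B2 C2 => {ABC}.
  move: #|A| #|B| #|C| => r' [|s'] // [|t'] // s2 t2.
  (* With [k = 0], [l = s - 1], [m = t - 1] the condition on [b] rearranges to the stated
     inequality; the other three then follow. *)
  rewrite /=; split=> [[_ h _ _]|h].
    by have := h s2; nia.
  by split; [lia | nia | nia | nia].
split.
  move=> r s t [A [B [C [ABC [bA wB bC] [<- <- <-]]]]].
  rewrite (three_path_positive e_sym e_irr R ABC) (whiteE B) // !blackE //.
  case: bA bC => A2 _ [C2 _]; move: A2 C2 => {ABC}.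
  move: #|A| #|B| #|C| => [|r'] // s' [|t'] // r2 t2.
  (* For a white middle and black ends only the sign of [a] and [c] is a constraint; the edge sums
     are automatically positive. *)
  rewrite /=; split=> [[h _ _ _]|h]; first by have := h; lia.
  by split=> //; [nia | nia].
move=> r s t [A [B [C [ABC [bA bB bC] _]]]].
rewrite (three_path_positive e_sym e_irr R ABC) !blackE //.
case: bA bB bC => A2 _ [B2 _] [C2 _]; move: A2 B2 C2 => {ABC}.
move: #|A| #|B| #|C| => [|r'] // [|s'] // [|t'] // r2 s2 t2.
(* In the condition on [b] the two sides differ by [(s - 1) * (r + s + t - 1)], which is
   positive. *)
by rewrite /=; split; [lia | nia | nia | nia].
Qed.
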